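(* Let $\mathcal{G}=\mathcal{G}_1\bullet\mathcal{G}_2\bullet\cdots\bullet\mathcal{G}_N$ be a (complex- or real-valued) TT-tensor of size $I_1\times\cdots\times I_N$ and rank-$(R,\ldots,R)$, and let $\mathbf{A}^{(n)}$, $n=1,\ldots,N$, be matrices of size $I_n\times R$. The contraction matrices $\boldsymbol{\Psi}_{>n}=\mathbf{G}_{>n}\mathbf{A}_{>n}^{*}$ and $\boldsymbol{\Psi}_{<n}=\mathbf{G}_{<n}^T\mathbf{A}_{<n}^{*}$ satisfy the recursive formulas $$\boldsymbol{\Psi}_{>n} = [\mathcal{G}_{n+1}]_{(1)}\left(\boldsymbol{\Psi}_{>(n+1)}\odot\mathbf{A}^{(n+1)*}\right),\qquad n=1,\ldots,N-1,$$ $$\boldsymbol{\Psi}_{<n} = [\mathcal{G}_{n-1}]_{(3)}\left(\mathbf{A}^{(n-1)*}\odot\boldsymbol{\Psi}_{<(n-1)}\right),\qquad n=2,\ldots,N,$$ where $\boldsymbol{\Psi}_{>N}=\boldsymbol{\Psi}_{<1}=\mathbf{1}_R^T$. Using these formulas, $\boldsymbol{\Psi}_{>n}$ can be computed from $\boldsymbol{\Psi}_{>(n+1)}$ with a cost of $\mathcal{O}(I_{n+1}R^3)$ arithmetic operations, and $\boldsymbol{\Psi}_{<n}$ can be computed from $\boldsymbol{\Psi}_{<(n-1)}$ with a cost of $\mathcal{O}(I_{n-1}R^3)$ arithmetic operations.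
   Context: Tensor train contraction: for a tensor $\mathcal{A}$ of size $I_1\times\cdots\times I_N$ and a tensor $\mathcal{B}$ of size $J_1\times\cdots\times J_K$ with $I_N=J_1$, $\mathcal{A}\bullet\mathcal{B}$ is the tensor of size $I_1\times\cdots\times I_{N-1}\times J_2\times\cdots\times J_K$ with entries $\sum_{i_N=1}^{I_N} a_{i_1,\ldots,i_{N-1},i_N}\,b_{i_N,j_2,\ldots,j_K}$. TT-tensor of rank-$(R,\ldots,R)$: $\mathcal{G}_1\bullet\cdots\bullet\mathcal{G}_N$ with cores $\mathcal{G}_n$ of size $R_{n-1}\times I_n\times R_n$, where $R_0=R_N=1$ and $R_1=\cdots=R_{N-1}=R$. Singleton boundary modes are dropped in contractions; in the recursive formulas $\mathcal{G}_1$ is regarded as a $1\times I_1\times R$ tensor and $\mathcal{G}_N$ as an $R\times I_N\times 1$ tensor. Unfolding: $\mathcal{X}_{(n)}$ or $[\mathcal{X}]_{(n)}$ is the mode-$n$ matricization, whose $i_n$-th row is the vectorization of the sub-tensor of $\mathcal{X}$ with $n$-th index fixed to $i_n$ (column-major order: earlier indices vary fastest). $\odot$ is the Khatri--Rao (columnwise Kronecker) product, the superscript $*$ the (entrywise) complex conjugate, $\mathbf{1}_R$ the column vector of ones of length $R$. Definitions of the matrices: $\mathbf{G}_{<n}=\left([\mathcal{G}_1\bullet\mathcal{G}_2\bullet\cdots\bullet\mathcal{G}_{n-1}]_{(n)}\right)^T$ for $n\ge2$, of size $(I_1\cdots I_{n-1})\times R$ (the unfolding is along the last mode, of dimension $R$);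 $\mathbf{G}_{>n}=[\mathcal{G}_{n+1}\bullet\mathcal{G}_{n+2}\bullet\cdots\bullet\mathcal{G}_N]_{(1)}$ for $n\le N-1$, of size $R\times(I_{n+1}\cdots I_N)$; $\mathbf{A}_{<n}=\mathbf{A}^{(n-1)}\odot\cdots\odot\mathbf{A}^{(1)}$ for $n\ge 2$ and $\mathbf{A}_{>n}=\mathbf{A}^{(N)}\odot\cdots\odot\mathbf{A}^{(n+1)}$ for $n\le N-1$. Convention: $\boldsymbol{\Psi}_{<1}=\boldsymbol{\Psi}_{>N}=\mathbf{1}_R^T$. *)

(* Defs.v *)
From mathcomp Require Import all_boot all_order all_algebra.
From mathcomp Require Import reals complex mxtens.

Set Implicit Arguments.
Unset Strict Implicit.
Unset Printing Implicit Defensive.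

Import GRing.Theory.
Local Open Scope ring_scope.

Inductive scalar_kind := RealValued | ComplexValued.

Definition scalar_field (F : realType) (k : scalar_kind) : fieldType :=
  match k with RealValued => F | ComplexValued => F[i]%C end.

Definition scalar_conj (F : realType) (k : scalar_kind) :
    scalar_field F k -> scalar_field F k :=
  match k with RealValued => id | ComplexValued => conjc end.

(* Positions inside a multi-index start at 0, so the entry written
   x_{i_1,...,i_d} on paper is read at [:: i_1 - 1; ...; i_d - 1]. *)
Definition multi_index (d : seq nat) := {ix : seq nat | all2 ltn ix d}.

Definition coefs (K : Type) (d : seq nat) := multi_index d -> K.

Record tensor (K : Type) := Tensor { dims : seq nat; coef : coefs K dims }.
Arguments Tensor {K} dims coef.

(* Number of entries of an array of size d.  A nonempty d is folded without a
   trailing factor 1, so that numel [:: m; q] is convertible to (q * m)%N, the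
   number of rows of a Khatri-Rao product. *)
Fixpoint numel (d : seq nat) : nat :=
  match d with
  | [::] => 1%N
  | x :: d' => if d' is [::] then x else (numel d' * x)%N
  end.

Lemma numelE d : numel d = (\prod_(x <- d) x)%N.
Proof.
elim: d => [|x [|y d] IH]; rewrite ?big_nil ?big_seq1 //.
by rewrite big_cons -IH mulnC.
Qed.

(* The multi-index at position j of a vectorized array of size d: earlier
   indices vary fastest. *)
Fixpoint unvec_index (d : seq nat) (j : nat) : seq nat :=
  if d is x :: d' then (j %% x)%N :: unvec_index d' (j %/ x)%N else [::].

(* Modes are numbered from 1. *)
Definition other_modes (n : nat) (d : seq nat) := take n.-1 d ++ drop n d.

Section TensorOperations.
Variable K : fieldType.
Implicit Types X Y : tensor K.

Definition entry X (ix : seq nat) : K := oapp (@coef K X) 0 (insub ix).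

Definition build (d : seq nat) (f : seq nat -> K) : tensor K :=
  Tensor d (fun ix => f (val ix)).

(* Meaningful when the last mode of X and the first mode of Y have the same
   size. *)
Definition contract X Y : tensor K :=
  let p := (size (dims X)).-1 in
  build (take p (dims X) ++ behead (dims Y))
    (fun ix => \sum_(k < last 0%N (dims X))
       entry X (rcons (take p ix) k) * entry Y ((k : nat) :: drop p ix)).

Definition unfolding (n : nat) X :
    'M[K]_(nth 0%N (dims X) n.-1, numel (other_modes n (dims X))) :=
  \matrix_(i, j)
    let jx := unvec_index (other_modes n (dims X)) j in
    entry X (take n.-1 jx ++ (i : nat) :: drop n.-1 jx).

(* Meaningful when the mode dropped has size 1. *)
Definition drop_first_mode X : tensor K :=
  build (behead (dims X)) (fun ix => entry X (0%N :: ix)).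
Definition drop_last_mode X : tensor K :=
  build (take (size (dims X)).-1 (dims X)) (fun ix => entry X (rcons ix 0%N)).

Definition khatri_rao m p q (A : 'M[K]_(m, q)) (B : 'M[K]_(p, q)) :
    'M[K]_(m * p, q) :=
  \matrix_(i, j) (col j A *t col j B) i ord0.

End TensorOperations.

Definition tt_rank (N R k : nat) : nat :=
  if (k == 0)%N || (k == N) then 1%N else R.

Section TensorTrain.
Variables (K : fieldType) (cj : K -> K) (N R : nat) (I : nat -> nat).
Local Notation r := (tt_rank N R).

(* Only the members 1, ..., N of the families G and A are ever used. *)
Variable G : forall k : nat, coefs K [:: r k.-1; I k; r k].
Variable A : forall k : nat, 'M[K]_(I k, R).

Definition core (k : nat) : tensor K := Tensor [:: r k.-1; I k; r k] (@G k).

(* The core as it enters contractions: singleton boundary modes dropped. *)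
Definition trimmed_core (k : nat) : tensor K :=
  let X := if k == N then drop_last_mode (core k) else core k in
  if k == 1%N then drop_first_mode X else X.

(* G_a • G_(a+1) • ... • G_b, for a <= b *)
Definition tt_chain (a b : nat) : tensor K :=
  foldl (@contract K) (trimmed_core a)
        [seq trimmed_core k | k <- index_iota a.+1 b.+1].

Definition modes_lt n := index_iota 1 n.
Definition modes_gt n := index_iota n.+1 N.+1.

Lemma dims_foldl_contract X d y a m :
    (1 < a)%N -> (a + m <= N.+1)%N -> dims X = rcons d y ->
  dims (foldl (@contract K) X [seq trimmed_core k | k <- iota a m]) =
    d ++ (if m is m'.+1 then map I (iota a m) ++
            (if a + m' == N then [::] else [:: r (a + m')]) else [:: y])%N.
Proof.
elim: m a X d y => [|m IH] a X d y lt1a leN dX; first by rewrite /= dX cats1.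
have dc : dims (contract X (trimmed_core a)) =
    d ++ I a :: (if a == N then [::] else [:: r a]).
  rewrite /= dX size_rcons /= -cats1 take_size_cat //; congr (_ ++ _).
  by rewrite /trimmed_core (gtn_eqF lt1a); case: (a == N).
have -> s : foldl (@contract K) X (map trimmed_core (iota a s.+1)) =
  foldl (@contract K) (contract X (trimmed_core a))
        (map trimmed_core (iota a.+1 s)) by [].
case: m IH leN => [|m] IH leN; first by rewrite [LHS]dc /= addn0.
have aN : (a == N) = false.
  by apply/ltn_eqF; rewrite -ltnS (leq_trans _ leN) // !addnS !ltnS leq_addr.
rewrite (IH _ _ (rcons d (I a)) (r a)).
- by rewrite cat_rcons /= addSnnS.
- exact: ltnW.
- by rewrite addSnnS.
- by rewrite dc aN -!cats1 -catA.
Qed.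

(* The sizes declared for G_lt and G_gt below are those of the unfoldings. *)
Lemma dims_tt_chain_lt n : (1 < n <= N)%N ->
  dims (tt_chain 1 n.-1) = rcons (map I (modes_lt n)) (r n.-1).
Proof.
case: n => [|[|n]] //= ltnN.
rewrite /tt_chain /modes_lt /index_iota !subSS !subn0.
have d1 : dims (trimmed_core 1) = rcons [:: I 1%N] (r 1%N).
  by rewrite /trimmed_core (ltn_eqF (leq_trans _ ltnN)).
rewrite (dims_foldl_contract _ _ d1) //; last exact: leqW.
case: n ltnN d1 => [|n] ltnN _ //.
by rewrite add2n (ltn_eqF ltnN) -cats1.
Qed.

Lemma dims_tt_chain_gt n : (0 < n < N)%N ->
  dims (tt_chain n.+1 N) = r n :: map I (modes_gt n).
Proof.
case/andP=> n_gt0 ltnN; rewrite /tt_chain /modes_gt /index_iota !subSS.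
have n_eq0 : (n.+1 == 1)%N = false by rewrite eqSS gtn_eqF.
have [eN|neN] := eqVneq n.+1 N.
  have -> : (N - n.+1 = 0)%N by rewrite -eN subnn.
  have -> : (N - n = 1)%N by rewrite -eN subSnn.
  by rewrite /= /trimmed_core n_eq0; move/eqP: eN => ->.
have dn : dims (trimmed_core n.+1) = rcons [:: r n; I n.+1] (r n.+1).
  by rewrite /trimmed_core (negPf neN) n_eq0.
have ltn1N : (n.+1 < N)%N by rewrite ltn_neqAle neN.
rewrite (dims_foldl_contract _ _ dn) //; last by rewrite addSn subnKC.
rewrite -(subnSK ltnN) -(subnSK ltn1N) /=.
by rewrite subnKC // eqxx cats0.
Qed.

(* [conform_mx 0] only transports the unfolding along the propositional
   equality of sizes given by the two lemmas above. *)
Definition G_lt n : 'M[K]_(numel (map I (modes_lt n)), r n.-1) :=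
  (conform_mx 0 (unfolding n (tt_chain 1 n.-1)))^T.

Definition G_gt n : 'M[K]_(r n, numel (map I (modes_gt n))) :=
  conform_mx 0 (unfolding 1 (tt_chain n.+1 N)).

(* kr_chain [:: a; a+1; ...; b] = A^(b) ⊙ ... ⊙ A^(a+1) ⊙ A^(a) *)
Fixpoint kr_chain (ks : seq nat) : 'M[K]_(numel (map I ks), R) :=
  match ks return 'M[K]_(numel (map I ks), R) with
  | [::] => const_mx 1
  | k :: ks' =>
      match ks' return 'M[K]_(numel (map I ks'), R) ->
                       'M[K]_(numel (map I (k :: ks')), R) with
      | [::] => fun _ => A k
      | _ :: _ => fun B => khatri_rao B (A k)
      end (kr_chain ks')
  end.

Definition A_lt n := kr_chain (modes_lt n).
Definition A_gt n := kr_chain (modes_gt n).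

(* At the ends n = 1 and n = N, where r 0 = r N = 1, the contraction matrix is
   by convention the row vector of ones. *)
Definition Psi_lt n : 'M[K]_(r n.-1, R) :=
  if n == 1%N then const_mx 1 else (G_lt n)^T *m map_mx cj (A_lt n).

Definition Psi_gt n : 'M[K]_(r n, R) :=
  if n == N then const_mx 1 else G_gt n *m map_mx cj (A_gt n).

End TensorTrain.

(* Straight-line programs over K with inputs indexed by V.  Every operation
   costs one unit; constants and the reading of inputs are free.  A program is
   fixed before the values of its inputs are known. *)
Section StraightLinePrograms.
Variables (K : fieldType) (cj : K -> K) (V : Type).

(* Reg i is the result of the i-th executed operation (counted from 0). *)
Inductive operand := Input of V | Const of K | Reg of nat.

Inductive operation :=
  | Add of operand & operand
  | Sub of operand & operand
  | Mul of operand & operand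
  | Div of operand & operand
  | Conj of operand.

Record program (m n : nat) :=
  Program { code : seq operation; output : 'I_m -> 'I_n -> operand }.

Definition cost m n (P : program m n) : nat := size (code P).

Section Semantics.
Variable env : V -> K.

Definition operand_val (regs : seq K) (o : operand) : K :=
  match o with Input v => env v | Const c => c | Reg i => nth 0 regs i end.

Definition operation_val (regs : seq K) (op : operation) : K :=
  let v := operand_val regs in
  match op with
  | Add a b => v a + v b
  | Sub a b => v a - v b
  | Mul a b => v a * v b
  | Div a b => v a / v b
  | Conj a => cj (v a)
  end.

Definition exec (ops : seq operation) : seq K :=
  foldl (fun regs op => rcons regs (operation_val regs op)) [::] ops.

Definition run m n (P : program m n) : 'M[K]_(m, n) :=
  \matrix_(i, j) operand_val (exec (code P)) (output P i j).

End Semantics.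
End StraightLinePrograms.

(* Inputs of one recursion step: the entries of a core of size d, of a
   contraction matrix of size a x R and of a factor matrix of size b x R. *)
Inductive step_input (d : seq nat) (a b R : nat) :=
  | CoreEntry of multi_index d
  | PsiEntry of 'I_a & 'I_R
  | FactorEntry of 'I_b & 'I_R.

Definition step_env (K : Type) d a b R (X : coefs K d) (P : 'M[K]_(a, R))
    (B : 'M[K]_(b, R)) (v : step_input d a b R) : K :=
  match v with
  | CoreEntry ix => X ix
  | PsiEntry i j => P i j
  | FactorEntry i j => B i j
  end.

(* Main.v *)
(* Vectorized sums turn into iterated sums over the separate modes, peeled off
   at the front or at the back.  Contraction is associative as soon as the
   middle factor has two modes, so the first core splits off on the left of
   G_(n+1) • ... • G_N (the last core of G_1 • ... • G_(n-1) splits off on the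
   right by definition), and the Khatri-Rao factor of the same mode splits off
   with it.  For the cost, the product formula is evaluated entry by entry: each
   of the at most I R^3 terms takes one conjugation, two multiplications and one
   addition; a boundary rank 1 is at most R unless R = 0, when there is nothing
   to compute. *)
Require Import Defs.
From mathcomp Require Import all_boot all_order all_algebra.
From mathcomp Require Import reals complex mxtens boolp.

Set Implicit Arguments.
Unset Strict Implicit.
Unset Printing Implicit Defensive.

Import GRing.Theory.
Local Open Scope ring_scope.

(** * Range checks and lengths of multi-indices *)

Lemma all2_cat (S T : Type) (e : S -> T -> bool) s1 s2 t1 t2 :
  size s1 = size t1 ->
  all2 e (s1 ++ s2) (t1 ++ t2) = all2 e s1 t1 && all2 e s2 t2.
Proof. by elim: s1 t1 => [|x s1 IH] [|y t1] //= [/IH->]; rewrite andbA. Qed.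

Lemma all2_size (S T : Type) (e : S -> T -> bool) s t :
  all2 e s t -> size s = size t.
Proof. by rewrite all2E => /andP[/eqP]. Qed.

Lemma size_unvec_index d j : size (unvec_index d j) = size d.
Proof. by elim: d j => //= x d IH j; rewrite IH. Qed.

(** * Sums over vectorized positions as iterated sums over modes *)

Section Sums.
Variable K : fieldType.

Lemma sum_mxtens p m (F : 'I_(p * m) -> K) :
  \sum_c F c = \sum_(k < p) \sum_(a < m) F (mxtens_index (k, a)).
Proof.
rewrite pair_big (reindex (@mxtens_index p m)) /=.
  by apply: eq_bigr => -[].
by exists (@mxtens_unindex p m) => c _; rewrite (mxtens_indexK, mxtens_unindexK).
Qed.

Lemma sum_unvec_cons x d (f : seq nat -> K) :
  \sum_(c < numel (x :: d)) f (unvec_index (x :: d) c) =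
  \sum_(a < x) \sum_(c < numel d) f ((a : nat) :: unvec_index d c).
Proof.
case: d => [|y d].
  by apply: eq_bigr => a _; rewrite big_ord1 /= modn_small.
(* The range is convertible to [numel (y :: d) * x], and the fast digit of a position in it is the
   index of the first mode. *)
rewrite [LHS](@sum_mxtens (numel (y :: d)) x) exchange_big.
apply: eq_bigr => a _; apply: eq_bigr => c _.
have x_gt0 : (0 < x)%N by apply: leq_trans (ltn_ord a).
rewrite [mxtens_index _]lock [unvec_index (x :: _) _]/= -lock /=.
by rewrite modnMDl divnMDl // modn_small // divn_small // addn0.
Qed.

(** The last mode is reached by peeling off the modes before it from the front; the sums are then
    exchanged and the peeled modes put back. *)
Lemma sum_unvec_rcons x d (f : seq nat -> K) :
  \sum_(c < numel (rcons d x)) f (unvec_index (rcons d x) c) =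
  \sum_(a < x) \sum_(c < numel d) f (rcons (unvec_index d c) a).
Proof.
elim: d f => [|y d IH] f; first by rewrite [LHS]sum_unvec_cons.
rewrite rcons_cons sum_unvec_cons.
under eq_bigr => a _ do rewrite (IH (fun ix => f ((a : nat) :: ix))).
rewrite exchange_big; apply: eq_bigr => b _.
by rewrite (sum_unvec_cons y d (fun ix => f (rcons ix b))).
Qed.

(** Serves the last rank, which equals 1 only propositionally, whereas [tt_rank N R 0] reduces to
    1. *)
Lemma sum_ord_eq1 p (F : nat -> K) : p = 1%N -> \sum_(k < p) F k = F 0%N.
Proof. by move->; rewrite big_ord1. Qed.

End Sums.

(** * Entries of tensors, associativity of contraction, products with unfoldings *)

Section Tensors.
Variable K : fieldType.
Implicit Types X Y Z : tensor K.

Lemma entry_out X ix : ~~ all2 ltn ix (dims X) -> entry X ix = 0.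
Proof. by move=> out; rewrite /entry insubN. Qed.

Lemma entry_build d f ix :
  entry (@build K d f) ix = if all2 ltn ix d then f ix else 0.
Proof.
by case: ifPn => [ok|out]; [rewrite /entry insubT | rewrite entry_out].
Qed.

Lemma tensor_ext X Y : dims X = dims Y -> entry X =1 entry Y -> X = Y.
Proof.
case: X Y => [d f] [d' g] /= e; subst d' => eXY; congr Tensor.
by apply: funext => ix; have := eXY (val ix); rewrite /entry valK.
Qed.

Lemma entry_contract X Y ix :
  let p := (size (dims X)).-1 in
  entry (contract X Y) ix =
  \sum_(k < last 0%N (dims X))
     entry X (rcons (take p ix) k) * entry Y ((k : nat) :: drop p ix).
Proof.
move=> p; rewrite /contract entry_build -/p; case: ifPn => // out.
(* By contraposition: a nonzero summand has both factors read in range, and this puts [ix] in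
   range. *)
rewrite big1 // => k _; apply/eqP; rewrite mulf_eq0; apply: contraR out.
rewrite negb_or => /andP[].
case: (boolP (all2 ltn (rcons (take p ix) k) (dims X)))
  => [okX _|/entry_out->]; last by rewrite eqxx.
case: (boolP (all2 ltn ((k : nat) :: drop p ix) (dims Y)))
  => [okY _|/entry_out->]; last by rewrite eqxx.
have := all2_size okX; rewrite size_rcons => szX.
case/lastP: (dims X) @p szX k okX okY => [|d y] //=.
rewrite size_rcons last_rcons /= => -[szX] k.
rewrite -!cats1 all2_cat // => /andP[okX _] okY.
case: (dims Y) okY => //= z d' /andP[_ okY].
by rewrite -{1}(cat_take_drop (size d) ix) take_size_cat // all2_cat // okX.
Qed.

(* The middle factor needs two distinct modes to contract. *)
Lemma contractA X Y Z :
  (0 < size (dims X))%N -> (1 < size (dims Y))%N ->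
  contract (contract X Y) Z = contract X (contract Y Z).
Proof.
move=> X_gt0 Y_gt1.
case eX: (dims X) / lastP X_gt0 => [|dX x] // _.
case eY: (dims Y) Y_gt1 => [|y dY] //; case/lastP: dY eY => [|dY y'] // eY _.
have dimsE X' Y' : dims (contract X' Y') =
  take (size (dims X')).-1 (dims X') ++ behead (dims Y') by [].
have dXY : dims (contract X Y) = rcons (dX ++ dY) y'.
  by rewrite dimsE eX eY size_rcons /= rcons_cat -[rcons dX x]cats1 take_size_cat.
have dYZ : dims (contract Y Z) = y :: dY ++ behead (dims Z).
  by rewrite dimsE eY /= size_rcons /= -cats1 take_size_cat.
have dE : dims (contract (contract X Y) Z) = dX ++ dY ++ behead (dims Z).
  by rewrite dimsE dXY size_rcons -cats1 take_size_cat // catA.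
have dE' : dims (contract X (contract Y Z)) = dX ++ dY ++ behead (dims Z).
  by rewrite dimsE dYZ eX size_rcons -cats1 take_size_cat.
apply: tensor_ext => [|ix]; first by rewrite dE dE'.
(* Outside the common range both sides are 0; inside it the length of [ix] is known, as the
   splitting below requires. *)
have [ok|out] := boolP (all2 ltn ix (dX ++ dY ++ behead (dims Z))); last first.
  by rewrite !entry_out ?dE ?dE'.
have szix : size ix = (size dX + size (dY ++ behead (dims Z)))%N.
  by rewrite (all2_size ok) size_cat.
rewrite !entry_contract dXY eX !last_rcons !size_rcons size_cat /=.
under eq_bigr => l _ do rewrite entry_contract eX last_rcons size_rcons mulr_suml.
under [RHS]eq_bigr => k _ do
  rewrite entry_contract eY /= last_rcons size_rcons /= mulr_sumr.
rewrite exchange_big /=; apply: eq_bigr => k _; apply: eq_bigr => l _.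
(* Both sides now run over the same two contracted modes. The index is cut into [u], the free modes
   of [X], and [v], those of [Y] and [Z]. *)
rewrite -mulrA takeD.
set u := take _ ix; set v := drop _ ix.
have szu : size u = size dX by rewrite size_takel // szix leq_addr.
have szv : (size dY <= size v)%N.
  by rewrite size_drop szix addKn size_cat leq_addr.
have -> : drop (size dX + size dY) ix = drop (size dY) v.
  by rewrite drop_drop addnC.
by rewrite -szu !rcons_cat take_size_cat // drop_size_cat.
Qed.

(** Repeated associativity pulls the first factor out of a left-nested chain. *)
Lemma foldl_contract X Y s :
  (0 < size (dims X))%N -> (1 < size (dims Y))%N ->
  all (fun Z => 1 < size (dims Z))%N s ->
  foldl (@contract K) (contract X Y) s =
  contract X (foldl (@contract K) Y s).
Proof.
move=> X_gt0; elim: s Y => //= Z s IH Y Y_gt1 /andP[Z_gt1 s_gt1].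
rewrite contractA // IH // /contract /=.
(* Contracting two factors with at least two modes each leaves at least two modes, so the induction
   hypothesis applies to [contract Y Z]. *)
rewrite size_cat size_takel ?leq_pred // size_behead.
by case: (size _) Y_gt1 (size _) Z_gt1 => [|[|m]] // _ [|[|q]] // _; rewrite addnS.
Qed.

Lemma khatri_raoE m p q (A : 'M[K]_(m, q)) (B : 'M[K]_(p, q)) c j :
  khatri_rao A B c j = A (mxtens_unindex c).1 j * B (mxtens_unindex c).2 j.
Proof. by rewrite !mxE. Qed.

(** With the target sizes as variables, the two equations can be eliminated, and [conform_mx]
    becomes the identity. *)
Lemma conform_unfoldingE n X m' n' (i : 'I_m') (j : 'I_n') :
  nth 0%N (dims X) n.-1 = m' -> numel (other_modes n (dims X)) = n' ->
  conform_mx (0 : 'M_(m', n')) (unfolding n X) i j =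
  let jx := unvec_index (other_modes n (dims X)) j in
  entry X (take n.-1 jx ++ (i : nat) :: drop n.-1 jx).
Proof.
move=> em en; case: m' / em i; case: n' / en j => j i.
by rewrite conform_mx_id mxE.
Qed.

(** Column [k * b + l] of the unfolding and the row of the Khatri-Rao product at that position
    decode to the same pair [(k, l)]. *)
Lemma unfolding1_mul a b p R (X : coefs K [:: a; b; p]) (P : 'M[K]_(p, R))
    (B : 'M[K]_(b, R)) i j :
  (unfolding 1 (Tensor _ X) *m khatri_rao P B) i j =
  \sum_(k < p) \sum_(l < b)
     entry (Tensor _ X) [:: (i : nat); (l : nat); (k : nat)] *
     (P k j * B l j).
Proof.
rewrite mxE [LHS](@sum_mxtens _ p b); apply: eq_bigr => k _; apply: eq_bigr => l _.
have b_gt0 : (0 < b)%N by apply: leq_trans (ltn_ord l).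
rewrite khatri_raoE mxtens_indexK mxE /= modnMDl divnMDl //.
by rewrite (divn_small (ltn_ord l)) addn0 !modn_small.
Qed.

(** The same decoding at [l * a + k]: here the first mode varies fastest, so the factor [P] stands
    on the right of the product. *)
Lemma unfolding3_mul a b p R (X : coefs K [:: a; b; p]) (P : 'M[K]_(a, R))
    (B : 'M[K]_(b, R)) i j :
  (unfolding 3 (Tensor _ X) *m khatri_rao B P) i j =
  \sum_(l < b) \sum_(k < a)
     entry (Tensor _ X) [:: (k : nat); (l : nat); (i : nat)] *
     (B l j * P k j).
Proof.
rewrite mxE [LHS](@sum_mxtens _ b a); apply: eq_bigr => l _; apply: eq_bigr => k _.
have a_gt0 : (0 < a)%N by apply: leq_trans (ltn_ord k).
rewrite khatri_raoE mxtens_indexK mxE /= modnMDl divnMDl //.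
by rewrite (divn_small (ltn_ord k)) addn0 !modn_small.
Qed.

End Tensors.

(** * The tensor train: entries of the contraction matrices and the two recursions *)

Section TensorTrain.
Variables (K : fieldType) (cj : K -> K) (N R : nat) (I : nat -> nat).
Hypothesis cjM : {morph cj : x y / x * y}.
Local Notation r := (tt_rank N R).
Variable G : forall k : nat, coefs K [:: r k.-1; I k; r k].
Variable A : forall k : nat, 'M[K]_(I k, R).
Local Notation chain := (tt_chain G).
Implicit Type n : nat.

(** Rows are addressed by plain numbers, with value 0 out of range, to match multi-indices that are
    lists of numbers. *)
Definition factor_entry (k a : nat) (j : 'I_R) : K :=
  oapp (fun a' => A k a' j) 0 (insub a).

Lemma factor_entryE k (a : 'I_(I k)) j : factor_entry k a j = A k a j.
Proof. by rewrite /factor_entry valK. Qed.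

(** An entry of a Khatri-Rao chain as a product over modes. This form splits at either end, while
    [kr_chain] splits only at the front. *)
Definition kr_entry (ks ix : seq nat) (j : 'I_R) : K :=
  \prod_(p <- zip ks ix) factor_entry p.1 p.2 j.

Arguments kr_entry : simpl never.

Lemma kr_entry_cons k ks a ix j :
  kr_entry (k :: ks) (a :: ix) j = factor_entry k a j * kr_entry ks ix j.
Proof. by rewrite /kr_entry /= big_cons. Qed.

Lemma kr_entry_rcons k ks a ix j : size ks = size ix ->
  kr_entry (rcons ks k) (rcons ix a) j = kr_entry ks ix j * factor_entry k a j.
Proof. by move=> e; rewrite /kr_entry zip_rcons // big_rcons. Qed.

(** Quotient and remainder of a Khatri-Rao row number are the digits that [unvec_index] extracts;
    the cases follow those of [kr_chain]. *)
Lemma kr_chainE ks c j :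
  kr_chain A ks c j = kr_entry ks (unvec_index (map I ks) c) j.
Proof.
elim: ks c => [|k [|l ks] IH] c.
- by rewrite /kr_entry big_nil mxE.
- by rewrite /kr_entry /= big_seq1 modn_small // factor_entryE.
transitivity (kr_chain A (l :: ks) (mxtens_unindex c).1 j * A k (mxtens_unindex c).2 j).
  exact: khatri_raoE.
by rewrite [RHS]kr_entry_cons mulrC IH -factor_entryE.
Qed.

Lemma Psi_gtE n i j : (0 < n < N)%N ->
  Psi_gt cj G A n i j =
  \sum_(c < numel (map I (modes_gt N n)))
    (let ix := unvec_index (map I (modes_gt N n)) c in
     entry (chain n.+1 N) ((i : nat) :: ix) * cj (kr_entry (modes_gt N n) ix j)).
Proof.
move=> nN; rewrite /Psi_gt ifN; last by case/andP: nN => _ /ltn_eqF->.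
have dE := dims_tt_chain_gt G nN.
have oE : other_modes 1 (dims (chain n.+1 N)) = map I (modes_gt N n).
  by rewrite dE /other_modes /= drop0.
rewrite mxE; apply: eq_bigr => c _; rewrite mxE kr_chainE.
rewrite /G_gt conform_unfoldingE ?oE ?dE //=.
by rewrite take0 drop0.
Qed.

Lemma Psi_ltE n i j : (1 < n <= N)%N ->
  Psi_lt cj G A n i j =
  \sum_(c < numel (map I (modes_lt n)))
    (let ix := unvec_index (map I (modes_lt n)) c in
     entry (chain 1 n.-1) (rcons ix i) * cj (kr_entry (modes_lt n) ix j)).
Proof.
move=> nN; rewrite /Psi_lt ifN; last by case/andP: nN => /gtn_eqF->.
have dE := dims_tt_chain_lt G nN.
have szE : size (map I (modes_lt n)) = n.-1.
  by rewrite size_map size_iota subn1.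
have oE : other_modes n (dims (chain 1 n.-1)) = map I (modes_lt n).
  rewrite dE /other_modes drop_oversize ?size_rcons ?szE; last by case: (n) nN.
  by rewrite -cats1 take_cat szE ltnn subnn take0 !cats0.
rewrite mxE; apply: eq_bigr => c _; rewrite !mxE kr_chainE.
rewrite conform_unfoldingE ?oE //; last by rewrite dE nth_rcons szE ltnn eqxx.
by rewrite /= take_oversize ?drop_oversize ?cats1 // size_unvec_index szE.
Qed.

Lemma Psi_gt_last n i j : n = N -> Psi_gt cj G A n i j = 1.
Proof. by move/eqP=> e; rewrite /Psi_gt e mxE. Qed.

(** Core [n.+1] is neither first nor last, hence untrimmed, and [foldl_contract] moves it outside
    the left-nested chain. *)
Lemma chain_gt n : (0 < n)%N -> (n.+1 < N)%N ->
  chain n.+1 N = contract (core G n.+1) (chain n.+2 N).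
Proof.
move=> n_gt0 nN; rewrite /tt_chain /index_iota [in LHS]subSS -(subnSK nN) /=.
have tE k : (1 < k)%N -> trimmed_core G k =
    if k == N then drop_last_mode (core G k) else core G k.
  by move=> k_gt1; rewrite /trimmed_core (gtn_eqF k_gt1).
(* Beyond position 1 at most the trailing mode is dropped, which leaves two modes for
   associativity. *)
have gt1 k : (1 < k)%N -> (1 < size (dims (trimmed_core G k)))%N.
  by move=> k_gt1; rewrite tE //; case: ifP.
rewrite foldl_contract ?gt1 // ?tE ?(ltn_eqF nN) //.
rewrite all_map; apply/allP => k.
by rewrite mem_iota => /andP[k_gt _]; rewrite /= gt1 // (leq_trans _ k_gt).
Qed.

Lemma chain_lt n : (1 < n < N)%N ->
  chain 1 n = contract (chain 1 n.-1) (core G n).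
Proof.
case: n => [|[|n]] // nN.
rewrite /tt_chain /index_iota !subSS !subn0 -[n.+1 in LHS]addn1 iotaD map_cat foldl_cat /=.
by rewrite /trimmed_core add2n /= (ltn_eqF nN).
Qed.

Lemma Psi_gt_rec n : (1 <= n <= N.-1)%N ->
  Psi_gt cj G A n =
  unfolding 1 (core G n.+1) *m
    khatri_rao (Psi_gt cj G A n.+1) (map_mx cj (A n.+1)).
Proof.
case/andP=> n_gt0 nN1.
have nN : (n < N)%N.
  rewrite (leq_ltn_trans nN1) // ltn_predL (leq_trans n_gt0) //.
  exact: leq_trans nN1 (leq_pred N).
apply/matrixP => i j; rewrite (@Psi_gtE n) ?n_gt0 // (unfolding1_mul (X := @G n.+1)).
have modesE : modes_gt N n = n.+1 :: modes_gt N n.+1.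
  by rewrite /modes_gt /index_iota !subSS -subnSK.
rewrite modesE /= (sum_unvec_cons _ _ (fun ix => entry (chain n.+1 N)
  ((i : nat) :: ix) * cj (kr_entry (n.+1 :: modes_gt N n.+1) ix j))).
under [LHS]eq_bigr => a _ do under eq_bigr => c _ do
  rewrite /= kr_entry_cons cjM factor_entryE.
(* At [n.+1 = N] the chain is a single trimmed core, the previous contraction matrix is all ones,
   and the rank sum has one term. *)
have [eN|neN] := eqVneq n.+1 N.
  have -> : modes_gt N n.+1 = [::] by rewrite eN /modes_gt /index_iota subnn.
  have -> : chain n.+1 N = drop_last_mode (core G n.+1).
    rewrite eN /tt_chain /index_iota subnn /= /trimmed_core eqxx.
    by rewrite gtn_eqF // -eN.
  rewrite [RHS]exchange_big; apply: eq_bigr => a _.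
  (* The empty product is absorbed under [cj] by multiplicativity, without evaluating [cj 1]. *)
  rewrite big_ord1 /kr_entry big_nil -cjM mulr1 entry_build /= !ltn_ord /=.
  under eq_bigr => k _ do rewrite (Psi_gt_last _ _ eN) mul1r mxE.
  rewrite -mulr_suml; congr (_ * _).
  rewrite (sum_ord_eq1 (fun k => entry (core G n.+1) [:: i : nat; a : nat; k])) //.
  by rewrite /tt_rank eN eqxx orbT.
have n1N : (n.+1 < N)%N by rewrite ltn_neqAle neN.
(* The right side is reordered to sum over mode [n.+1], then the later modes, then the rank index
   that [entry_contract] produces on the left. *)
under [RHS]eq_bigr => k _ do under eq_bigr => a _ do
  rewrite mxE (@Psi_gtE n.+1) //= mulr_suml mulr_sumr.
rewrite [RHS]exchange_big; apply: eq_bigr => a _.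
rewrite [RHS]exchange_big; apply: eq_bigr => c _.
rewrite (chain_gt n_gt0 n1N) entry_contract mulr_suml.
by apply: eq_bigr => k _; rewrite /= take0 drop0 -!mulrA [cj (A _ _ _) * _]mulrC. 
Qed.

Lemma Psi_lt_rec n : (2 <= n <= N)%N ->
  Psi_lt cj G A n =
  unfolding 3 (core G n.-1) *m
    khatri_rao (map_mx cj (A n.-1)) (Psi_lt cj G A n.-1).
Proof.
case: n => [|[|n]] // nN; rewrite [n.+2.-1]/=.
apply/matrixP => i j; rewrite (@Psi_ltE n.+2) // (unfolding3_mul (X := @G n.+1)).
have -> : modes_lt n.+2 = rcons (modes_lt n.+1) n.+1.
  by rewrite /modes_lt /index_iota !subSS !subn0 -[n.+1 in LHS]addn1 iotaD cats1.
rewrite map_rcons /= (sum_unvec_rcons _ _ (fun ix => entry (chain 1 n.+1)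
  (rcons ix i) * cj (kr_entry (rcons (modes_lt n.+1) n.+1) ix j))).
apply: eq_bigr => a _.
under [LHS]eq_bigr => c _ do
  rewrite /= kr_entry_rcons ?size_unvec_index ?size_map // cjM factor_entryE.
(* The base case is the formula for the second matrix: the chain is the first core without its
   singleton mode, and the preceding matrix is all ones. *)
case: n => [|n] in i nN a *.
  rewrite !big_ord1 /kr_entry big_nil -cjM mul1r /Psi_lt !mxE mulr1.
  rewrite /tt_chain /= /trimmed_core (ltn_eqF nN) entry_build /=.
  by rewrite !ltn_ord.
have nN' : (1 < n.+2 <= N)%N by exact: (ltnW (nN : (n.+2 < N)%N)).
under [RHS]eq_bigr => k _ do rewrite mxE (@Psi_ltE n.+2) // mulr_sumr mulr_sumr.
rewrite [RHS]exchange_big; apply: eq_bigr => c _.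
set u := unvec_index _ c.
have szu : size (map I (modes_lt n.+2)) = size u by rewrite size_unvec_index.
rewrite (@chain_lt n.+2) // entry_contract (dims_tt_chain_lt G nN').
rewrite last_rcons size_rcons [_.+1.-1]/= szu mulr_suml.
apply: eq_bigr => k _; clearbody u.
rewrite -!cats1 -catA take_size_cat // drop_size_cat //= !cats1.
rewrite [_ * entry (core _ _) _]mulrC -mulrA; congr (_ * _).
by rewrite mulrA [RHS]mulrC.
Qed.

End TensorTrain.

(** * Composition of straight-line code with cost bounds *)

Section Programs.
Variables (K : fieldType) (cj : K -> K) (V : Type).
Implicit Types (env : V -> K) (f g : (V -> K) -> K) (regs : seq K).
Implicit Types (ops : seq (operation K V)) (o : operand K V) (c k : nat).

(** Starting from arbitrary registers lets code fragments be concatenated; [exec] is the case of no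
    registers. *)
Definition exec_from env regs ops : seq K :=
  foldl (fun regs' op => rcons regs' (operation_val cj env regs' op)) regs ops.

Lemma size_exec_from env regs ops :
  size (exec_from env regs ops) = (size regs + size ops)%N.
Proof.
elim: ops regs => [|op ops IH] regs; first by rewrite addn0.
by rewrite [LHS]IH size_rcons addSnnS.
Qed.

Lemma exec_from_cat env regs ops1 ops2 :
  exec_from env regs (ops1 ++ ops2) =
  exec_from env (exec_from env regs ops1) ops2.
Proof. exact: foldl_cat. Qed.

(** Registers are appended and never overwritten, so earlier results keep their positions. *)
Lemma exec_from_prefix env regs ops :
  exists regs', exec_from env regs ops = regs ++ regs'.
Proof.
elim/last_ind: ops => [|ops op [regs' IH]]; first by exists [::]; rewrite cats0.
rewrite -cats1 exec_from_cat IH /= -cats1 -catA.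
by exists (regs' ++ [:: operation_val cj env (regs ++ regs') op]).
Qed.

(* The code may be placed after any k operations, and its result survives all
   later ones. *)
Definition computable c f := forall k, exists ops o,
  (size ops <= c)%N /\
  forall env regs regs', size regs = k ->
    operand_val env (exec_from env regs ops ++ regs') o = f env.

Lemma computable_ext c f g : f =1 g -> computable c f -> computable c g.
Proof.
move=> fg cf k; have [ops [o [sz H]]] := cf k.
by exists ops, o; split=> // env regs regs' e; rewrite H // fg.
Qed.

Lemma computable_input v : computable 0 (fun env => env v).
Proof. by move=> k; exists [::], (Input K v). Qed.

Lemma computable_const x : computable 0 (fun=> x).
Proof. by move=> k; exists [::], (Const V x). Qed.

Lemma computable_conj c f :
  computable c f -> computable c.+1 (fun env => cj (f env)).
Proof.
move=> cf k; have [ops [o [sz H]]] := cf k.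
(* Registers count from 0, so the operation executed after [k + size ops] others fills the register
   of that number. *)
exists (rcons ops (Conj o)), (Reg K V (k + size ops)).
split=> [|env regs regs' e]; first by rewrite size_rcons.
rewrite -cats1 exec_from_cat /= nth_cat size_rcons size_exec_from e leqnn.
rewrite nth_rcons size_exec_from e ltnn eqxx.
by rewrite -(H env regs [::]) // cats0.
Qed.

Lemma computable_op2 (op : operand K V -> operand K V -> operation K V)
    (h : K -> K -> K) c1 c2 f g :
  (forall env regs o1 o2, operation_val cj env regs (op o1 o2) =
     h (operand_val env regs o1) (operand_val env regs o2)) ->
  computable c1 f -> computable c2 g ->
  computable (c1 + c2).+1 (fun env => h (f env) (g env)).
Proof.
move=> opE cf cg k; have [ops1 [o1 [sz1 H1]]] := cf k.
(* The second fragment runs after the first, hence the shifted offset. *)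
have [ops2 [o2 [sz2 H2]]] := cg (k + size ops1)%N.
exists (rcons (ops1 ++ ops2) (op o1 o2)).
exists (Reg K V (k + (size ops1 + size ops2))).
split=> [|env regs regs' e]; first by rewrite size_rcons size_cat ltnS leq_add.
rewrite -cats1 !exec_from_cat /= nth_cat size_rcons !size_exec_from e.
rewrite addnA leqnn nth_rcons !size_exec_from e ltnn eqxx opE.
rewrite -[X in operand_val env X o2]cats0 H2 ?size_exec_from ?e //.
have [regs2 ->] := exec_from_prefix env (exec_from env regs ops1) ops2.
by rewrite H1.
Qed.

Lemma computable_add c1 c2 f g : computable c1 f -> computable c2 g ->
  computable (c1 + c2).+1 (fun env => f env + g env).
Proof. exact: computable_op2 (@Add K V) _ _ _ _ _ _. Qed.

Lemma computable_mul c1 c2 f g : computable c1 f -> computable c2 g ->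
  computable (c1 + c2).+1 (fun env => f env * g env).
Proof. exact: computable_op2 (@Mul K V) _ _ _ _ _ _. Qed.

(** Starting from the free constant 0, each term is charged its own cost and one addition. *)
Lemma computable_sum c n (F : 'I_n -> (V -> K) -> K) :
  (forall i, computable c (F i)) ->
  computable (n * c.+1) (fun env => \sum_(i < n) F i env).
Proof.
elim: n F => [|n IH] F cF.
  apply: computable_ext (computable_const 0) => env; by rewrite big_ord0.
apply: (@computable_ext _ (fun env =>
    \sum_(i < n) F (widen_ord (leqnSn n) i) env + F ord_max env)).
  by move=> env; rewrite big_ord_recr.
by rewrite mulSn addnC addnS; apply: computable_add => //; apply: IH.
Qed.

(** The fragments are concatenated, and each result is still readable after the later fragments have
    run. This computes all entries of a matrix in one program. *)
Lemma computable_seq (T : eqType) c (F : T -> (V -> K) -> K) (s : seq T) k :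
  (forall x, computable c (F x)) ->
  exists ops (out : T -> operand K V), (size ops <= size s * c)%N /\
  forall env regs regs' x, size regs = k -> x \in s ->
    operand_val env (exec_from env regs ops ++ regs') (out x) = F x env.
Proof.
move=> cF; elim: s k => [|y s IH] k; first by exists [::], (fun=> Const V 0).
have [ops1 [o [sz1 H1]]] := cF y k.
have [ops2 [out [sz2 H2]]] := IH (k + size ops1)%N.
exists (ops1 ++ ops2), (fun x => if x == y then o else out x).
split=> [|env regs regs' x e]; first by rewrite size_cat mulSn leq_add.
rewrite inE exec_from_cat; case: eqP => [-> _|_ /= xs].
  have [regs2 ->] := exec_from_prefix env (exec_from env regs ops1) ops2.
  by rewrite -catA H1.
by rewrite H2 // size_exec_from e.
Qed.

Lemma computable_program m n c (F : 'I_m -> 'I_n -> (V -> K) -> K) :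
  (forall i j, computable c (F i j)) ->
  exists P : program K V m n, (cost P <= m * n * c)%N /\
    forall env, run cj env P = \matrix_(i, j) F i j env.
Proof.
move=> cF.
have [x|ops [out [sz H]]] :=
  @computable_seq _ c (fun x => F x.1 x.2) (enum {: 'I_m * 'I_n}) 0.
  exact: cF.
exists (Program ops (fun i j => out (i, j))); split=> [|env].
  by rewrite (leq_trans sz) // -cardE card_prod !card_ord.
apply/matrixP => i j; rewrite !mxE /= -[exec cj env ops]cats0.
by rewrite (H env [::]) // mem_enum.
Qed.

Lemma computable_mulmx m q n c1 c2 (M : (V -> K) -> 'M[K]_(m, q))
    (B : (V -> K) -> 'M[K]_(q, n)) :
  (forall i l, computable c1 (fun env => M env i l)) ->
  (forall l j, computable c2 (fun env => B env l j)) ->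
  exists P : program K V m n, (cost P <= m * n * (q * (c1 + c2).+2))%N /\
    forall env, run cj env P = M env *m B env.
Proof.
move=> cM cB.
have [i j|P [costP runP]] := @computable_program m n (q * (c1 + c2).+2)
    (fun i j env => \sum_l M env i l * B env l j).
  by apply: computable_sum => l; apply: computable_mul.
by exists P; split=> // env; rewrite runP; apply/matrixP => i j; rewrite !mxE.
Qed.

End Programs.

(** * Programs for one recursion step *)

Section StepPrograms.
Variables (K : fieldType) (cj : K -> K) (d : seq nat) (a b R : nat).
Local Notation V := (step_input d a b R).

(** Reads the core back from an arbitrary valuation of the inputs, since a program is fixed before
    their values; on [step_env] this returns the core by conversion. *)
Definition env_tensor (env : V -> K) : tensor K :=
  Tensor d (fun ix => env (CoreEntry a b R ix)).

Definition env_psi (env : V -> K) : 'M[K]_(a, R) :=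
  \matrix_(i, j) env (PsiEntry d b i j).

Definition env_factor (env : V -> K) : 'M[K]_(b, R) :=
  \matrix_(i, j) env (FactorEntry d a i j).

(** Each entry is read at an index independent of the environment: it is an input or the constant 0,
    both free. *)
Lemma computable_unfolding n (i : 'I_(nth 0%N d n.-1))
    (j : 'I_(numel (other_modes n d))) :
  computable cj 0 (fun env => unfolding n (env_tensor env) i j).
Proof.
set ix := take n.-1 (unvec_index (other_modes n d) j) ++
  (i : nat) :: drop n.-1 (unvec_index (other_modes n d) j).
apply: (@computable_ext _ _ _ _ (fun env => entry (env_tensor env) ix)) => [env|].
  by rewrite mxE.
rewrite /entry /=; case: insub => [mx|] /=.
  exact: computable_input.
exact: computable_const.
Qed.

Lemma computable_psi i j : computable cj 0 (fun env => env_psi env i j).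
Proof.
apply: computable_ext (computable_input cj (PsiEntry d b i j)) => env.
by rewrite mxE.
Qed.

Lemma computable_conj_factor i j :
  computable cj 1 (fun env => map_mx cj (env_factor env) i j).
Proof.
apply: computable_ext (computable_conj (computable_input cj (FactorEntry d a i j))).
by move=> env; rewrite !mxE.
Qed.

Lemma step_envK (X : coefs K d) (P : 'M[K]_(a, R)) (B : 'M[K]_(b, R)) :
  let env := step_env X P B in (env_psi env = P) * (env_factor env = B).
Proof. by split; apply/matrixP => i j; rewrite mxE. Qed.

End StepPrograms.

Section StepProgramsCost.
Variables (K : fieldType) (cj : K -> K) (a b p R : nat).

Lemma gt_step_program :
  exists P : program K (step_input [:: a; b; p] p b R) a R,
    (cost P <= 4 * (a * R * (p * b)))%N /\
    forall X Psi B, run cj (step_env X Psi B) P =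
      unfolding 1 (Tensor _ X) *m khatri_rao Psi (map_mx cj B).
Proof.
pose M := fun env : step_input [:: a; b; p] p b R -> K =>
  unfolding 1 (env_tensor env).
pose B := fun env : step_input [:: a; b; p] p b R -> K =>
  khatri_rao (env_psi env) (map_mx cj (env_factor env)).
(* Entries of the unfolding cost 0; those of the Khatri-Rao product cost 2, a conjugation and a
   multiplication. The matrix product adds 2 per term, which gives the factor 4. *)
have [i k|k j|P [costP runP]] := @computable_mulmx K cj _ a (p * b) R 0 2 M B.
- exact: computable_unfolding.
- apply: (@computable_ext _ _ _ _ (fun env =>
    env_psi env (mxtens_unindex k).1 j *
    map_mx cj (env_factor env) (mxtens_unindex k).2 j)) => [env|].
    by rewrite khatri_raoE.
  apply: (@computable_mul _ _ _ 0 1); first exact: computable_psi.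
  exact: computable_conj_factor.
exists P; split; first by rewrite mulnC -mulnA.
by move=> X Psi B'; rewrite runP /M /B !step_envK.
Qed.

Lemma lt_step_program :
  exists P : program K (step_input [:: a; b; p] a b R) p R,
    (cost P <= 4 * (p * R * (b * a)))%N /\
    forall X Psi B, run cj (step_env X Psi B) P =
      unfolding 3 (Tensor _ X) *m khatri_rao (map_mx cj B) Psi.
Proof.
pose M := fun env : step_input [:: a; b; p] a b R -> K =>
  unfolding 3 (env_tensor env).
pose B := fun env : step_input [:: a; b; p] a b R -> K =>
  khatri_rao (map_mx cj (env_factor env)) (env_psi env).
have [i k|k j|P [costP runP]] := @computable_mulmx K cj _ p (b * a) R 0 2 M B.
- exact: computable_unfolding.
- apply: (@computable_ext _ _ _ _ (fun env =>
    map_mx cj (env_factor env) (mxtens_unindex k).1 j *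
    env_psi env (mxtens_unindex k).2 j)) => [env|].
    by rewrite khatri_raoE.
  apply: (@computable_mul _ _ _ 1 0); last exact: computable_psi.
  exact: computable_conj_factor.
exists P; split; first by rewrite mulnC -mulnA.
by move=> X Psi B'; rewrite runP /M /B !step_envK.
Qed.

End StepProgramsCost.

(** * Scalars, ranks and the final cost bound *)

Lemma scalar_conjM (F : realType) (kind : scalar_kind) :
  {morph @scalar_conj F kind : x y / x * y}.
Proof. by case: kind => // x y; apply: rmorphM. Qed.

Lemma tt_rank_inner N R k : (0 < k < N)%N -> tt_rank N R k = R.
Proof.
by case/andP=> k_gt0 kN; rewrite /tt_rank (gtn_eqF k_gt0) (ltn_eqF kN).
Qed.

Lemma step_cost_le N R k b :
  (4 * (R * R * (tt_rank N R k * b)) <= 4 * (b * R ^ 3))%N.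
Proof.
case: R => [|R]; first by rewrite !mul0n muln0.
have rank_le : (tt_rank N R.+1 k <= R.+1)%N by rewrite /tt_rank; case: ifP.
have -> : (b * R.+1 ^ 3 = R.+1 * R.+1 * (R.+1 * b))%N.
  by rewrite !expnS expn0 muln1 [RHS]mulnA [RHS]mulnC -[in RHS]mulnA.
by rewrite !leq_mul.
Qed.

Theorem lemma4 (F : realType) (kind : scalar_kind) :
  let K := scalar_field F kind in
  let cj := @scalar_conj F kind in
  (forall (N R : nat) (I : nat -> nat)
      (G : forall k : nat, coefs K [:: tt_rank N R k.-1; I k; tt_rank N R k])
      (A : forall k : nat, 'M[K]_(I k, R)),
    (forall n : nat, (1 <= n <= N.-1)%N ->
       Psi_gt cj G A n =
         unfolding 1 (core G n.+1) *m
           khatri_rao (Psi_gt cj G A n.+1) (map_mx cj (A n.+1)))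
    /\
    (forall n : nat, (2 <= n <= N)%N ->
       Psi_lt cj G A n =
         unfolding 3 (core G n.-1) *m
           khatri_rao (map_mx cj (A n.-1)) (Psi_lt cj G A n.-1)))
  /\
  (exists C : nat, forall (N R : nat) (I : nat -> nat),
    (forall n : nat, (1 <= n <= N.-1)%N ->
       exists P : program K
           (step_input [:: tt_rank N R n; I n.+1; tt_rank N R n.+1]
                       (tt_rank N R n.+1) (I n.+1) R)
           (tt_rank N R n) R,
         [/\ (cost P <= C * (I n.+1 * R ^ 3))%N,
             forall (X : coefs K [:: tt_rank N R n; I n.+1; tt_rank N R n.+1])
                    (Psi : 'M[K]_(tt_rank N R n.+1, R))
                    (B : 'M[K]_(I n.+1, R)),
               run cj (step_env X Psi B) P =
                 unfolding 1 (Tensor _ X) *m khatri_rao Psi (map_mx cj B)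
           & forall
               (G : forall k : nat,
                      coefs K [:: tt_rank N R k.-1; I k; tt_rank N R k])
               (A : forall k : nat, 'M[K]_(I k, R)),
               run cj (step_env (G n.+1) (Psi_gt cj G A n.+1) (A n.+1)) P =
                 Psi_gt cj G A n])
    /\
    (forall n : nat, (2 <= n <= N)%N ->
       exists P : program K
           (step_input [:: tt_rank N R n.-2; I n.-1; tt_rank N R n.-1]
                       (tt_rank N R n.-2) (I n.-1) R)
           (tt_rank N R n.-1) R,
         [/\ (cost P <= C * (I n.-1 * R ^ 3))%N,
             forall (X : coefs K [:: tt_rank N R n.-2; I n.-1; tt_rank N R n.-1])
                    (Psi : 'M[K]_(tt_rank N R n.-2, R))
                    (B : 'M[K]_(I n.-1, R)),
               run cj (step_env X Psi B) P =
                 unfolding 3 (Tensor _ X) *m khatri_rao (map_mx cj B) Psi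
           & forall
               (G : forall k : nat,
                      coefs K [:: tt_rank N R k.-1; I k; tt_rank N R k])
               (A : forall k : nat, 'M[K]_(I k, R)),
               run cj (step_env (G n.-1) (Psi_lt cj G A n.-1) (A n.-1)) P =
                 Psi_lt cj G A n])).
Proof.
move=> K cj; have cjM : {morph cj : x y / x * y} by apply: scalar_conjM.
split=> [N R I G A|]; first by split=> n nN; [exact: Psi_gt_rec | exact: Psi_lt_rec].
(* The constant is the cost of one term of the matrix product. *)
exists 4 => N R I; split=> n nN.
- have [P [costP runP]] := gt_step_program cj (tt_rank N R n) (I n.+1)
    (tt_rank N R n.+1) R.
  exists P; split=> [||G A] //; last by rewrite runP; apply/esym/Psi_gt_rec.
  (* The output rank is [R] because [n] lies strictly between 0 and [N]; only the rank at [n.+1] can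
     be a boundary one. *)
  apply: leq_trans costP _; rewrite (@tt_rank_inner N R n) ?step_cost_le //.
  by case: N nN {P runP} => [|N]; case: n.
- have [P [costP runP]] := lt_step_program cj (tt_rank N R n.-2) (I n.-1)
    (tt_rank N R n.-1) R.
  exists P; split=> [||G A] //; last by rewrite runP; apply/esym/Psi_lt_rec.
  apply: leq_trans costP _.
  rewrite [(I n.-1 * _)%N]mulnC (@tt_rank_inner N R n.-1) ?step_cost_le //.
  by case: n nN {P runP} => [|[|n]].
Qed.
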